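(* There exists a universal constant $c>0$ with the following property. Let $H$ be a limit circle Hamburger Hamiltonian with lengths $(l_j)_{j=1}^\infty$ and angles $(\phi_j)_{j=1}^\infty$. Suppose $\alpha,\beta\ge1$ are such that $$(l_j)_{j=1}^\infty\in\ell^{\frac1\alpha},\qquad\big(|\sin(\phi_{j+1}-\phi_j)|\big)_{j=1}^\infty\in\ell^{\frac1\beta}.$$ Then $$\log|w_{H,22}(ir)|\ \le\ r^{\frac1{\alpha+\beta}}\cdot 2c(\alpha+\beta)\Big(\sum_{j=1}^\infty l_j^{\frac1\alpha}\Big)^{\frac{\alpha}{\alpha+\beta}}\Big(1+\sum_{j=1}^\infty|\sin(\phi_{j+1}-\phi_j)|^{\frac1\beta}\Big)^{\frac{\beta}{\alpha+\beta}}$$ for all sufficiently large $r$.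
   Context: Limit circle Hamburger Hamiltonian: let $(l_j)_{j=1}^\infty$ be positive numbers (''lengths'') with $L:=\sum_{j=1}^\infty l_j<\infty$, and $(\phi_j)_{j=1}^\infty$ real numbers (''angles'') with $\phi_{j+1}-\phi_j\notin\pi\mathbb{Z}$ for all $j$. Put $x_0:=0$, $x_n:=\sum_{j=1}^n l_j$, $\xi_\phi:=(\cos\phi,\sin\phi)^\top$, and $H(t):=\xi_{\phi_j}\xi_{\phi_j}^\top$ for $x_{j-1}\le t<x_j$, $j\in\mathbb{N}$; this defines $H$ on $(0,L)$. Monodromy matrix: with $J=\begin{pmatrix}0&-1\\1&0\end{pmatrix}$, for $z\in\mathbb{C}$ let $W_H(t;z)$ be the solution of $\frac{d}{dt}W_H(t;z)J=zW_H(t;z)H(t)$ for a.e. $t\in(0,L)$, $W_H(0;z)=I$. It exists up to $t=L$, and $W_H(z):=W_H(L;z)=(w_{H,ij}(z))_{i,j=1}^2$. For $p>0$, $(u_j)\in\ell^p$ means $\sum_j|u_j|^p<\infty$. ''Universal'' means independent of $H$, $\alpha$ and $\beta$. *)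

(* Defs.v *)
From mathcomp Require Import all_boot all_order all_algebra.
From mathcomp Require Import complex.
From mathcomp Require Import all_classical all_reals all_analysis.

Set Implicit Arguments.
Unset Strict Implicit.
Unset Printing Implicit Defensive.

Import Order.TTheory GRing.Theory Num.Theory.
Import numFieldNormedType.Exports.

Local Open Scope classical_set_scope.
Local Open Scope ring_scope.
Local Open Scope complex_scope.

(* Sequences are indexed from 0: [l j] and [phi j] stand for l_{j+1} and
   phi_{j+1}, so that x_n = series l n = \sum_(0 <= j < n) l j. *)

Definition limit_circle_hamburger (R : realType) (l phi : nat -> R) : Prop :=
  [/\ forall j, 0 < l j,
      cvgn (series l)
    & forall (j : nat) (k : int), phi j.+1 - phi j != k%:~R * pi].

Definition xi (R : realType) (a : R) : 'cV[R]_2 :=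
  \col_(i < 2) (if i == 0 then cos a else sin a).

(* For positive lengths at most one j satisfies the constraint; H is only
   meaningful on [0, L[, where such a j exists. *)
Definition hamburger_H (R : realType) (l phi : nat -> R) (t : R) : 'M[R]_2 :=
  let j := xget 0%N [set j : nat | series l j <= t < series l j.+1] in
  xi (phi j) *m (xi (phi j))^T.

Definition Jmx (C : pzRingType) : 'M[C]_2 :=
  \matrix_(i < 2, j < 2)
    nth 0 (nth [::] [:: [:: 0; -1]; [:: 1; 0]] i) j.

Definition abs_continuous_on (R : realType) (a b : R) (f : R -> R) : Prop :=
  forall e : R, 0 < e -> exists2 d : R, 0 < d &
    forall (n : nat) (u v : 'I_n -> R),
      (forall i, [/\ a <= u i, u i <= v i & v i <= b]) ->
      trivIset [set: 'I_n] (fun i => `]u i, v i[%classic) ->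
      \sum_(i < n) (v i - u i) < d ->
      \sum_(i < n) `|f (v i) - f (u i)| < e.

(* [W] solves  W'(t) J = z W(t) H(t)  for a.e. t in ]0, L[,  W(0) = I,
   in the usual (Caratheodory) sense: W is absolutely continuous, here up to
   t = L.  Continuity and derivatives of complex entries are understood
   separately for real and imaginary parts. *)
Definition canonical_solution (R : realType) (H : R -> 'M[R]_2) (L : R)
    (z : R[i]) (W : R -> 'M[R[i]]_2) : Prop :=
  [/\ W 0 = 1%:M,
      forall i j : 'I_2,
        abs_continuous_on 0 L (fun t => complex.Re (W t i j)) /\
        abs_continuous_on 0 L (fun t => complex.Im (W t i j))
    & {ae @lebesgue_measure R, forall t : R, 0 < t < L ->
        exists2 dW : 'M[R[i]]_2,
          (forall i j : 'I_2,
             is_derive t (1 : R) (fun s => complex.Re (W s i j))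
               (complex.Re (dW i j)) /\
             is_derive t (1 : R) (fun s => complex.Im (W s i j))
               (complex.Im (dW i j)))
          & dW *m Jmx R[i] = z *: (W t *m map_mx (real_complex R) (H t))}].

Definition in_lp (R : realType) (p : R) (u : nat -> R) : Prop :=
  cvgn (series (fun j => `|u j| `^ p)).

(* Main.v *)
Require Import Defs.
From mathcomp Require Import all_boot all_order all_algebra.
From mathcomp Require Import complex.
From mathcomp Require Import all_classical all_reals all_analysis.
From mathcomp Require Import ring lra.

Import Order.TTheory GRing.Theory Num.Theory.
Import numFieldNormedType.Exports.

Local Open Scope classical_set_scope.
Local Open Scope ring_scope.
Local Open Scope complex_scope.

(** Only the second row [w] of the solution matters.  Write [xi_t] for
    [(cos t, sin t)] and [x_n] for the partial sums of the lengths, [L] for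
    their limit.  On [[x_n, x_(n+1)]] the Hamiltonian is the constant rank one
    matrix [xi xi^T] with [xi = xi_(phi_n)].  Since [xi^T J xi = 0], the pairing
    [w . xi] has zero derivative almost everywhere there.  An absolutely
    continuous function with this property is constant
    ([abs_continuous_derive0]), so [w] is affine on the interval and, for
    [z = i r],
    [w(x_(n+1)) = w(x_n) + i r l_n (w(x_n) . xi) (- sin phi_n, cos phi_n)]
    ([canonical_solution_step]).

    Put [a_n = |w(x_n) . xi_(phi_n)|], [M_n = max_t |w(x_n) . xi_t|] and
    [s_n = |sin (phi_(n+1) - phi_n)|].  The recurrence yields
    [M_(n+1) <= M_n + r l_n a_n] and [a_(n+1) <= a_n + s_n M_(n+1)].  Unfolding
    these, [M_n] is at most the sum over [k] of [r^k] times the [k]-th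
    elementary symmetric function of the lengths times that of
    [1, s_0, s_1, ...].  For [alpha >= 1] the power [alpha] is superadditive, so
    the [k]-th elementary symmetric function of [u_0, u_1, ...] is at most
    [(A^k / k!)^alpha], where [A] is the sum of the [u_j^(1/alpha)].  The proof
    uses these majorants directly: [powfact_rec] is the inequality by which they
    dominate Pascal's recurrence for symmetric functions, and [pairing_bound] is
    the resulting induction.

    Finally the sum over [k] of [r^k (A^k / k!)^alpha (B^k / k!)^beta] equals
    the sum of [(X^k / k!)^(alpha + beta)] with
    [X = r^(1/(alpha+beta)) A^(alpha/(alpha+beta)) B^(beta/(alpha+beta))].  By
    superadditivity it is at most [exp ((alpha + beta) X)]
    ([sum_powfact_le]).  This is uniform in [n] and passes to the limit by
    continuity of [w] at [L].  The bound holds with [c = 1/2] and for every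
    [r >= 0]. *)

(** * Powers and exponential sums *)

Lemma powR_superadditive {R : realType} (g x y : R) : 1 <= g -> 0 <= x -> 0 <= y ->
  x `^ g + y `^ g <= (x + y) `^ g.
Proof.
move=> g1 x0 y0.
have g0 : 0 < g by exact: lt_le_trans g1.
have h z : 0 <= z -> z <= x + y -> z `^ g <= z * (x + y) `^ (g - 1).
  move=> z0 zxy; rewrite -mulr_powRB1// ler_wpM2l// ge0_ler_powR//.
  - by rewrite subr_ge0.
  - by rewrite nnegrE addr_ge0.
rewrite -[leRHS]mulr_powRB1 ?addr_ge0// mulrDl.
by apply: lerD; apply: h; rewrite ?lerDl ?lerDr.
Qed.

Lemma sum_powR_le {R : realType} (g : R) (x : nat -> R) n : 1 <= g ->
  (forall k, 0 <= x k) ->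
  \sum_(k < n) x k `^ g <= (\sum_(k < n) x k) `^ g.
Proof.
move=> g1 x0; elim: n => [|n ih].
  by rewrite !big_ord0 powR_ge0.
rewrite !big_ord_recr/=.
apply: le_trans (powR_superadditive _ _ _ g1 _ (x0 n)); last exact: sumr_ge0.
by rewrite lerD2r.
Qed.

Lemma sum_exp_coeff_le {R : realType} (x : R) n : 0 <= x ->
  \sum_(k < n) x ^+ k / k`!%:R <= expR x.
Proof.
move=> x0; rewrite -(big_mkord xpredT (fun k => x ^+ k / k`!%:R)).
apply: (nondecreasing_cvgn_le (u_ := series (exp_coeff x))).
  apply/nondecreasing_seqP => m; rewrite /series/= big_nat_recr//= lerDl.
  by rewrite divr_ge0 ?exprn_ge0.
exact: is_cvg_series_exp_coeff.
Qed.

(** [powfact a A k] is [(A^k / k!)^a].  For [a >= 1] it is a majorant of the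
    [k]-th elementary symmetric function of nonnegative reals [u_0, u_1, ...]
    whose powers [u_j^(1/a)] sum up to [A]. *)
Definition powfact {R : realType} (a A : R) (k : nat) : R :=
  (A ^+ k / k`!%:R) `^ a.

Lemma powfact_ge0 {R : realType} (a A : R) k : 0 <= powfact a A k.
Proof. exact: powR_ge0. Qed.

Lemma powfact0 {R : realType} (a A : R) : powfact a A 0 = 1.
Proof. by rewrite /powfact expr0 fact0 divr1 powR1. Qed.

Lemma powfact_le {R : realType} (a A B : R) k :
  0 <= a -> 0 <= A -> A <= B -> powfact a A k <= powfact a B k.
Proof.
move=> a0 A0 AB; rewrite /powfact ge0_ler_powR// ?nnegrE ?divr_ge0 ?exprn_ge0//.
  exact: le_trans AB.
by rewrite ler_pM2r ?invr_gt0 ?ltr0n ?fact_gt0// lerXn2r ?nnegrE// (le_trans A0).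
Qed.

(** The elementary symmetric functions satisfy
    [e_(k+1)(u, x) = e_(k+1)(u) + x e_k(u)].  Their majorants satisfy it as an
    inequality, because the power [a] is superadditive and
    [A^(k+1) + (k+1) y A^k <= (A + y)^(k+1)] for [y = x^(1/a)]. *)
Lemma powfact_rec {R : realType} (a A x : R) k : 1 <= a -> 0 <= A -> 0 <= x ->
  powfact a A k.+1 + x * powfact a A k <= powfact a (A + x `^ (1 / a)) k.+1.
Proof.
move=> a1 A0 x0; have a0 : 0 < a by exact: lt_le_trans a1.
set y := x `^ (1 / a).
have y0 : 0 <= y by exact: powR_ge0.
have -> : x = y `^ a.
  by rewrite /y -powRrM div1r mulVf ?gt_eqF// powRr1.
rewrite /powfact -powRM ?divr_ge0 ?exprn_ge0//.
apply: le_trans (powR_superadditive _ _ _ a1 _ _) _.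
- by rewrite divr_ge0// exprn_ge0.
- by rewrite mulr_ge0// divr_ge0// exprn_ge0.
apply: ge0_ler_powR; rewrite ?nnegrE ?addr_ge0 ?mulr_ge0 ?invr_ge0 ?exprn_ge0
  ?addr_ge0 ?(ltW a0)//.
have f0 : 0 < (k`!%:R : R) by rewrite ltr0n fact_gt0.
have -> : A ^+ k.+1 / k.+1`!%:R + y * (A ^+ k / k`!%:R) =
    (A ^+ k.+1 + k.+1%:R * y * A ^+ k) / k.+1`!%:R.
  rewrite factS natrM; field.
  by rewrite gt_eqF// gt_eqF.
rewrite ler_pM2r ?invr_gt0 ?ltr0n ?fact_gt0//.
elim: k {f0} => [|k ih]; first by rewrite !expr1 expr0; lra.
rewrite [leRHS]exprS.
apply: (@le_trans _ _ ((A + y) * (A ^+ k.+1 + k.+1%:R * y * A ^+ k))).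
  have : 0 <= k.+1%:R * y * y * A ^+ k.
    by rewrite !mulr_ge0 ?exprn_ge0.
  rewrite -subr_ge0 => h; rewrite -subr_ge0.
  apply: le_trans h _; rewrite !exprS -(natr1 k.+1) subr0.
  by rewrite le_eqVlt; apply/orP; left; apply/eqP; ring.
by rewrite ler_wpM2l ?addr_ge0.
Qed.

(** With [x = r^(1/(a+b)) A^(a/(a+b)) B^(b/(a+b))] each summand is
    [(x^k / k!)^(a+b)], so that superadditivity of the power [a + b] compares
    the sum with that power of the exponential series. *)
Lemma sum_powfact_le {R : realType} (a b r A B : R) n :
  1 <= a -> 1 <= b -> 0 <= r -> 0 <= A -> 0 <= B ->
  \sum_(k < n) r ^+ k * powfact a A k * powfact b B k <=
  expR (r `^ (1 / (a + b)) * (a + b) *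
        A `^ (a / (a + b)) * B `^ (b / (a + b))).
Proof.
move=> a1 b1 r0 A0 B0.
have g0 : 0 < a + b by lra.
set x := r `^ (1 / (a + b)) * A `^ (a / (a + b)) * B `^ (b / (a + b)).
have x0 : 0 <= x by rewrite /x !mulr_ge0 ?powR_ge0.
have E k : r ^+ k * powfact a A k * powfact b B k = (x ^+ k / k`!%:R) `^ (a + b).
  have f0 : 0 <= (k`!%:R : R)^-1 by rewrite invr_ge0.
  rewrite /powfact !powRM ?exprn_ge0//.
  have -> : (x ^+ k) `^ (a + b) = r ^+ k * (A ^+ k) `^ a * (B ^+ k) `^ b.
    rewrite -!powR_mulrn// -!powRrM !(mulrC k%:R) !powRrM.
    rewrite -powRM ?powR_ge0// -powRM ?mulr_ge0 ?powR_ge0//; congr (_ `^ _).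
    rewrite /x !powRM ?mulr_ge0 ?powR_ge0// -!powRrM.
    by rewrite !divfK ?gt_eqF// powRr1.
  rewrite (@powRD _ _ a b); first ring.
  by rewrite gt_eqF.
under eq_bigr do rewrite E.
apply: le_trans (sum_powR_le (a + b) (fun k => x ^+ k / k`!%:R) n _ _) _.
- lra.
- by move=> k; rewrite divr_ge0 ?exprn_ge0.
apply: le_trans (ge0_ler_powR (ltW g0) _ _ (sum_exp_coeff_le x n x0)) _.
- by rewrite nnegrE sumr_ge0// => k _; rewrite divr_ge0 ?exprn_ge0.
- by rewrite nnegrE expR_ge0.
by rewrite -expRM /x le_eqVlt; apply/orP; left; apply/eqP; congr expR; ring.
Qed.

(** * The recurrence for the second row *)

(** The pairing [w . xi_t] of a row vector [w] of C^2, given by its two entries,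
    with the real unit vector [xi_t = (cos t, sin t)]. *)
Definition pairing {R : realType} (w : R[i] * R[i]) (t : R) : R[i] :=
  w.1 * (cos t)%:C + w.2 * (sin t)%:C.

Lemma normc_real {R : realType} (x : R) : Normc.normc x%:C = `|x|.
Proof. by rewrite /= expr0n addr0 sqrtr_sqr. Qed.

Lemma normc_im {R : realType} (x : R) : Normc.normc (0 +i* x) = `|x|.
Proof. by rewrite /= expr0n add0r sqrtr_sqr. Qed.

Lemma normc_ge0 {R : realType} (x : R[i]) : 0 <= Normc.normc x.
Proof. by case: x => x y; exact: sqrtr_ge0. Qed.

Lemma normc_le_ReIm {R : realType} (x : R[i]) :
  Normc.normc x <= `|complex.Re x| + `|complex.Im x|.
Proof.
case: x => x y.
have -> : (x +i* y) = x%:C + (0 +i* 1) * y%:C.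
  by apply/eqP; rewrite eq_complex/=; apply/andP; split; apply/eqP; ring.
apply: le_trans (le_normcD _ _) _; rewrite Normc.normcM !normc_real.
by rewrite normc_im normr1 mul1r /= !(mul0r, mul1r, mulr0, subr0, addr0, add0r).
Qed.

Section recurrence.
Context {R : realType}.
Variables (l phi : nat -> R) (a b r : R) (w : nat -> R[i] * R[i]).
Hypothesis l0 : forall n, 0 <= l n.
Hypothesis a1 : 1 <= a.
Hypothesis b1 : 1 <= b.
Hypothesis r0 : 0 <= r.
Hypothesis w0 : w 0%N = (0, 1).
Hypothesis wS : forall n,
  w n.+1 = ((w n).1 - (0 +i* (r * l n)) * pairing (w n) (phi n) * (sin (phi n))%:C,
            (w n).2 + (0 +i* (r * l n)) * pairing (w n) (phi n) * (cos (phi n))%:C).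

(** [A n] belongs to the lengths [l_0, ..., l_(n-1)], [B n] to the numbers
    [1, s_0, ..., s_(n-1)]. *)
Let s n := `|sin (phi n.+1 - phi n)|.
Let A n := series (fun j => l j `^ (1 / a)) n.
Let B n := 1 + series (fun j => s j `^ (1 / b)) n.

Let A0 n : 0 <= A n.
Proof. by rewrite /A /series/= sumr_ge0// => i _; rewrite powR_ge0. Qed.

Let B0 n : 0 <= B n.
Proof. by rewrite /B /series/= addr_ge0// sumr_ge0// => i _; rewrite powR_ge0. Qed.

Let AS n : A n.+1 = A n + l n `^ (1 / a).
Proof. by rewrite /A seriesSr. Qed.

Let BS n : B n.+1 = B n + s n `^ (1 / b).
Proof. by rewrite /B seriesSr addrA. Qed.

Lemma pairing_step n t :
  pairing (w n.+1) t = pairing (w n) t +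
    (0 +i* (r * l n)) * pairing (w n) (phi n) * (sin (t - phi n))%:C.
Proof.
rewrite sinB rmorphB !rmorphM/= wS /pairing/=.
set x := (w n).1; set y := (w n).2; ring.
Qed.

(** Decomposition of [xi_(phi_(n+1))] along [xi_(phi_n)] and its orthogonal.
    The step from [n] to [n + 1] does not change the pairing with
    [xi_(phi_n)]. *)
Lemma pairing_rotate n :
  pairing (w n.+1) (phi n.+1) =
    (cos (phi n.+1 - phi n))%:C * pairing (w n) (phi n) +
    (sin (phi n.+1 - phi n))%:C * pairing (w n.+1) (phi n + pi / 2).
Proof.
have -> : pairing (w n) (phi n) = pairing (w n.+1) (phi n).
  by rewrite pairing_step subrr sin0 mulr0 addr0.
rewrite /pairing sinDpihalf cosDpihalf.
set d := phi n.+1 - phi n.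
have -> : phi n.+1 = d + phi n by rewrite subrK.
rewrite cosD sinD rmorphB rmorphD !rmorphM rmorphN/=.
set x := (w n.+1).1; set y := (w n.+1).2; ring.
Qed.

(** The index [k + 1] in the first bound accounts for the number [1] put in
    front of the sines, that is for the summand [1] of [B n]. *)
Lemma pairing_bound n :
  (Normc.normc (pairing (w n) (phi n)) <=
     \sum_(k < n.+1) r ^+ k * powfact a (A n) k * powfact b (B n) k.+1) /\
  (forall t, Normc.normc (pairing (w n) t) <=
     \sum_(k < n.+1) r ^+ k * powfact a (A n) k * powfact b (B n) k).
Proof.
have ge0a : 0 <= a by exact: le_trans a1.
have ge0b : 0 <= b by exact: le_trans b1.
have trig1 x : (sin x : R) <= 1 /\ `|sin x| <= 1 /\ `|cos x| <= 1.
  by rewrite !ler_norml !sin_le1 !cos_le1 !sin_geN1 !cos_geN1.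
elim: n => [|n [ih1 ih2]].
  have h t : Normc.normc (pairing (w 0%N) t) <= 1.
    have -> : pairing (w 0%N) t = (sin t)%:C.
      by rewrite w0 /pairing/= mul0r add0r mul1r.
    rewrite normc_real.
    by have [_ []] := trig1 t.
  split=> [|t]; rewrite big_ord1 expr0 mul1r !powfact0 ?mulr1 ?mul1r//.
  have -> : B 0%N = 1 by rewrite /B /series/= big_nil addr0.
  by rewrite /powfact expr1 divr1 powR1.
(* This is sharper than the second claim at [n + 1], which has [B n.+1]: the
   sine [s n] is still available for the first claim at [n + 1]. *)
have key t : Normc.normc (pairing (w n.+1) t) <=
    \sum_(k < n.+2) r ^+ k * powfact a (A n.+1) k * powfact b (B n) k.
  rewrite pairing_step.
  apply: le_trans (le_normcD _ _) _.
  apply: (@le_trans _ _ (Normc.normc (pairing (w n) t) +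
      r * l n * Normc.normc (pairing (w n) (phi n)))).
    rewrite lerD2l !Normc.normcM normc_real.
    rewrite normc_im ger0_norm ?mulr_ge0//.
    rewrite ler_piMr//; last by have [_ []] := trig1 (t - phi n).
    by rewrite !mulr_ge0// normc_ge0.
  apply: le_trans (lerD (ih2 t) (ler_wpM2l _ ih1)) _; first by rewrite mulr_ge0.
  rewrite big_ord_recl [leRHS]big_ord_recl !expr0 !powfact0 -addrA lerD2l.
  apply: (@le_trans _ _ (\sum_(k < n.+1) r ^+ k.+1 * powfact a (A n) k.+1 *
      powfact b (B n) k.+1 + r * l n * (\sum_(k < n.+1) r ^+ k * powfact a (A n) k *
      powfact b (B n) k.+1))).
    rewrite lerD2r big_ord_recr/= lerDl.
    by rewrite !mulr_ge0 ?exprn_ge0 ?powfact_ge0.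
  rewrite mulr_sumr -big_split/= ler_sum// => k _.
  rewrite AS.
  have := @powfact_rec R a (A n) (l n) k a1 (A0 n) (l0 n).
  set P := powfact a (A n) k.+1; set P' := powfact a (A n) k.
  set P'' := powfact _ _ _; set Q := powfact _ _ _ => h.
  have -> : r ^+ k.+1 * P * Q + r * l n * (r ^+ k * P' * Q) =
      r ^+ k.+1 * (P + l n * P') * Q by rewrite exprS; ring.
  by rewrite ler_wpM2r ?powfact_ge0// ler_wpM2l ?exprn_ge0.
split=> [|t]; last first.
  apply: le_trans (key t) _.
  apply: ler_sum => k _; rewrite ler_wpM2l ?mulr_ge0 ?exprn_ge0 ?powfact_ge0//.
  by rewrite powfact_le// BS lerDl powR_ge0.
rewrite pairing_rotate.
apply: le_trans (le_normcD _ _) _.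
rewrite !Normc.normcM !normc_real.
apply: (@le_trans _ _ (Normc.normc (pairing (w n) (phi n)) +
    s n * Normc.normc (pairing (w n.+1) (phi n + pi / 2)))).
  rewrite lerD2r ler_piMl//; last by have [_ []] := trig1 (phi n.+1 - phi n).
  exact: normc_ge0.
apply: le_trans (lerD ih1 (ler_wpM2l _ (key _))) _; first exact: normr_ge0.
apply: (@le_trans _ _ (\sum_(k < n.+2) r ^+ k * powfact a (A n.+1) k *
   powfact b (B n) k.+1 + s n * \sum_(k < n.+2) r ^+ k * powfact a (A n.+1) k *
   powfact b (B n) k)).
  rewrite lerD2r [leRHS]big_ord_recr/=.
  apply: ler_wpDr; first by rewrite !mulr_ge0 ?exprn_ge0 ?powfact_ge0.
  apply: ler_sum => k _; rewrite ler_wpM2r ?powfact_ge0// ler_wpM2l ?exprn_ge0//.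
  by rewrite powfact_le// AS lerDl powR_ge0.
rewrite mulr_sumr -big_split/= ler_sum// => k _.
rewrite BS.
have := @powfact_rec R b (B n) (s n) k b1 (B0 n) (normr_ge0 _).
set P := powfact b (B n) k.+1; set P' := powfact b (B n) k.
set P'' := powfact b _ _; set Q := powfact _ _ _ => h.
have -> : r ^+ k * Q * P + s n * (r ^+ k * Q * P') =
    r ^+ k * Q * (P + s n * P') by ring.
by rewrite ler_wpM2l ?mulr_ge0 ?powfact_ge0 ?exprn_ge0.
Qed.

End recurrence.

(** * Absolutely continuous functions *)

(** Monotonicity of almost everywhere statements for the Lebesgue measure. *)
Lemma ae_imply {R : realType} (P Q : R -> Prop) : (forall x, P x -> Q x) ->
  {ae @lebesgue_measure R, forall x, P x} -> {ae @lebesgue_measure R, forall x, Q x}.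
Proof. by move=> PQ; apply: (@filterS _ (almost_everywhere lebesgue_measure)). Qed.

Lemma abs_continuous_on_sub {R : realType} (a b c d : R) (f : R -> R) :
  a <= c -> d <= b -> abs_continuous_on a b f -> abs_continuous_on c d f.
Proof.
move=> ac db acf e /acf [del del0 h]; exists del => // n u v uv.
apply: h => i; have [h1 h2 h3] := uv i; split => //.
  exact: le_trans h1.
exact: le_trans db.
Qed.

Lemma abs_continuous_on_lin {R : realType} (a b x y : R) (f g : R -> R) :
  abs_continuous_on a b f -> abs_continuous_on a b g ->
  abs_continuous_on a b (fun t => x * f t + y * g t).
Proof.
move=> acf acg e e0.
have z0 (z : R) : 0 < e / 2 / (`|z| + 1).
  by rewrite !divr_gt0// ltr_wpDl.
have [d1 d10 h1] := acf _ (z0 x).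
have [d2 d20 h2] := acg _ (z0 y).
exists (Num.min d1 d2); first by rewrite lt_min d10.
move=> n u v uv tI; rewrite lt_min => /andP[s1 s2].
have {}h1 := h1 n u v uv tI s1; have {}h2 := h2 n u v uv tI s2.
have bd (z S : R) : 0 <= S -> S < e / 2 / (`|z| + 1) -> `|z| * S < e / 2.
  move=> S0; rewrite ltr_pdivlMr ?ltr_wpDl//; apply: le_lt_trans.
  by rewrite mulrDr mulr1 mulrC lerDl.
apply: (@le_lt_trans _ _ (`|x| * (\sum_(i < n) `|f (v i) - f (u i)|) +
   `|y| * (\sum_(i < n) `|g (v i) - g (u i)|))).
  rewrite !mulr_sumr -big_split/= ler_sum// => i _.
  rewrite -!normrM; apply: le_trans (ler_normD _ _).
  by rewrite le_eqVlt; apply/orP; left; apply/eqP; congr `|_|; ring.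
rewrite [e]splitr.
by apply: ltrD; apply: bd; rewrite // sumr_ge0.
Qed.

Lemma abs_continuous_on_id {R : realType} (a b : R) : abs_continuous_on a b id.
Proof.
move=> e e0; exists e => // n u v uv _; apply: le_lt_trans.
apply: ler_sum => i _; rewrite ger0_norm ?subr_ge0//.
by have [] := uv i.
Qed.

Lemma abs_continuous_on_right {R : realType} (a b : R) (f : R -> R) (e : R) :
  abs_continuous_on a b f -> 0 < e -> exists2 d, 0 < d &
    forall u, a <= u -> u <= b -> b - u < d -> `|f b - f u| < e.
Proof.
move=> acf /acf[d d0 h]; exists d => // u au ub ud.
have := h 1%N (fun=> u) (fun=> b); rewrite !big_ord1; apply => //.
by move=> i j _ _ _; rewrite !ord1.
Qed.

Lemma is_derive0_near {R : realType} (f : R -> R) (x e : R) :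
  is_derive x 1 f 0 -> 0 < e ->
  exists2 h, 0 < h & forall y, `|y - x| < h -> `|f y - f x| <= e * `|y - x|.
Proof.
move=> [df df0] e0.
have : h^-1 *: (f (h *: 1 + x) - f x) @[h --> 0^'] --> 'D_1 f x.
  exact: df.
rewrite df0 => /cvgr0Pnorm_le => /(_ e e0) [h /= h0 H]; exists h => // y yx.
have [->|yNx] := eqVneq y x; first by rewrite !subrr normr0 mulr0.
have yx0 : y - x != 0 by rewrite subr_eq0.
have := H (y - x); rewrite /= sub0r normrN => /(_ yx yx0).
have -> : (y - x) *: 1 + x = y by rewrite /GRing.scale/= mulr1 subrK.
rewrite normrZ normfV mulrC ler_pdivrMr//; by rewrite normr_gt0.
Qed.

Section abs_continuous_derive0.
Context {R : realType}.
Variables (a b : R) (f : R -> R).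
Hypothesis ab : a <= b.

(** [reach U e t]: up to an error of [e] per unit length, the increment of [f]
    over [[a, t]] is carried by finitely many intervals [[u_i, v_i]], listed
    from left to right, whose interiors lie in [U].  Only the indices [i < n]
    matter. *)
Let reach (U : set R) (e t : R) := exists (n : nat) (u v : nat -> R),
  [/\ forall i, (i < n)%N -> [/\ a <= u i, u i <= v i & v i <= t],
      forall i, (i < n)%N -> `]u i, v i[%classic `<=` U,
      forall i j, (i < j < n)%N -> v i <= u j &
      `|f t - f a| <= e * (t - a) + \sum_(i < n) `|f (v i) - f (u i)|].

(** Near every point of [[a, b]] the predicate extends to the right: a point of
    [U] contributes one more interval, at any other point the derivative of [f]
    vanishes. *)
Let reach_step (U : set R) (e : R) : open U -> 0 < e ->
  (forall x, a <= x <= b -> ~ U x -> is_derive x 1 f 0) ->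
  forall x, a <= x <= b -> exists2 h, 0 < h &
  forall t t', a <= t -> t <= x -> x <= t' -> t' <= b -> x - h < t -> t' < x + h ->
  reach U e t -> reach U e t'.
Proof.
move=> oU e0 fU x axb; have [Ux|nUx] := pselect (U x).
  have [h /= h0 hU] := oU _ Ux.
  exists h => // t t' at_ tx xt' t'b xht t'xh [n [u [v [H1 H2 H3 H4]]]].
  have tt' : t <= t' by exact: le_trans xt'.
  exists n.+1, (fun i => if (i < n)%N then u i else t),
    (fun i => if (i < n)%N then v i else t'); split.
  - move=> i _; case: ifPn => [/H1[? ? vt]|_]; split => //.
    exact: le_trans tt'.
  - move=> i _; case: ifPn => [/H2//|_] y /=; rewrite in_itv/= => /andP[ty yt'].
    by apply: hU; rewrite /ball/= ltr_distlC; apply/andP; split; lra.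
  - move=> i j /andP[ij jn].
    have il : (i < n)%N by exact: leq_trans ij _.
    rewrite il; case: ifPn => jl; first by apply: H3; rewrite ij jl.
    by have [] := H1 _ il.
  - rewrite big_ord_recr/= ltnn.
    under eq_bigr => i _ do rewrite ltn_ord.
    have : `|f t' - f a| <= `|f t' - f t| + `|f t - f a|.
      by apply: le_trans (ler_normD _ _); rewrite subrKA.
    have : e * (t - a) <= e * (t' - a) by rewrite ler_pM2l// lerB.
    move: H4; set S := \sum_(i < n) _; lra.
have [h h0 H] := is_derive0_near f x e (fU _ axb nUx) e0.
exists h => // t t' at_ tx xt' t'b xht t'xh [n [u [v [H1 H2 H3 H4]]]].
have tt' : t <= t' by exact: le_trans xt'.
exists n, u, v; split => // [i /H1[? ? ?]|].
  by split => //; exact: le_trans tt'.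
have h1 : `|f t - f x| <= e * (x - t).
  rewrite -(ger0_norm (_ : 0 <= x - t)) ?subr_ge0// (distrC x) H//.
  by rewrite ler0_norm; lra.
have h2 : `|f t' - f x| <= e * (t' - x).
  rewrite -(ger0_norm (_ : 0 <= t' - x)) ?subr_ge0// H//.
  by rewrite ger0_norm; lra.
have : `|f t' - f a| <= `|f t' - f x| + (`|f t - f x| + `|f t - f a|).
  rewrite (distrC (f t)); apply: le_trans (lerD (lexx _) (ler_normD _ _)).
  by apply: le_trans (ler_normD _ _); rewrite subrKA subrKA.
move: H4 h1 h2; set S := \sum_(i < n) _.
rewrite !mulrBr; lra.
Qed.

(** Real induction: the supremum of the points reached is reached, and is [b]. *)
Let reach_end (U : set R) (e : R) : open U -> 0 < e ->
  (forall x, a <= x <= b -> ~ U x -> is_derive x 1 f 0) -> reach U e b.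
Proof.
move=> oU e0 fU.
pose S := [set t | a <= t <= b /\ reach U e t].
have Sa : S a.
  split; first by rewrite lexx.
  exists 0%N, (fun=> 0), (fun=> 0); split => //.
  by rewrite !subrr normr0 mulr0 big_ord0 addr0.
have Sb : ubound S b by move=> t [/andP[]].
have supS : has_sup S by split; [exists a|exists b].
set c := sup S.
have ac : a <= c by exact: sup_upper_bound supS _ Sa.
have cb : c <= b by apply: ge_sup => //; exists a.
have acb : a <= c <= b by rewrite ac.
have [h h0 H] := reach_step U e oU e0 fU c acb.
have [t [/andP[at_ tb] rt] cht] := sup_adherent h0 supS.
have tc : t <= c.
  by apply: (sup_upper_bound supS); split => //; rewrite at_.
have Hc t' : c <= t' -> t' <= b -> t' < c + h -> reach U e t'.
  by move=> ? ? ?; apply: (H t).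
have [bch|bch] := ltP b (c + h); first exact: Hc.
have r1 : reach U e (c + h / 2) by apply: Hc; lra.
have : c + h / 2 <= c.
  apply: (sup_upper_bound supS).
  by split => //; apply/andP; split; lra.
lra.
Qed.

(** The exceptional null set is covered by an open set [U] of measure so small
    that, by absolute continuity, the increments of [f] over disjoint intervals
    inside [U] add up to less than [e]. *)
Lemma abs_continuous_derive0 : abs_continuous_on a b f ->
  {ae @lebesgue_measure R, forall t, a < t < b -> is_derive t 1 f 0} ->
  f b = f a.
Proof.
move=> acf aef.
suff H e : 0 < e -> `|f b - f a| <= e * (b - a) + e.
  apply/eqP; rewrite -subr_eq0 -normr_le0; apply/ler_addgt0Pl => e e0.
  rewrite addr0; apply: le_trans (H (e / (b - a + 1)) _) _.
    by rewrite divr_gt0// ltr_wpDl// subr_ge0.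
  by rewrite -[X in _ + X]mulr1 -mulrDr divfK// gt_eqF// ltr_wpDl// subr_ge0.
move=> e0; have [d d0 acd] := acf _ e0.
have [N [mN N0 sN]] := aef.
(* The end points, where nothing is known of the derivative, are added to the
   exceptional set. *)
pose N' := N `|` ([set a] `|` [set b]).
have mN' : measurable N' by apply: measurableU => //; exact: measurableU.
have N'0 : lebesgue_measure N' = 0%E.
  have m2 : measurable ([set a] `|` [set b]) by exact: measurableU.
  rewrite /N' measureU0// measureU0//; exact: lebesgue_measure_set1.
have [|U [oU NU Ud]] := @lebesgue_regularity_outer R N' d mN' _ d0.
  by rewrite [X in (X < _)%E]N'0 ltry.
have mU : measurable U by exact: measurable_realfun.open_measurable.
have {}Ud : (lebesgue_measure U < d%:E)%E.
  apply: le_lt_trans Ud.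
  rewrite -[in leLHS](setDKU NU).
  apply: le_trans (measureU2 _ _ _) _ => //; first exact: measurableD.
  by rewrite [X in (_ + X)%E]N'0 adde0.
have [|n [u [v [H1 H2 H3 H4]]]] := reach_end U e oU e0.
  move=> x /andP[ax xb] nUx.
  have [xa|xa] := eqVneq x a; first by case: nUx; apply: NU; right; left.
  have [xb'|xb'] := eqVneq x b; first by case: nUx; apply: NU; right; right.
  have : ~ N x by move=> Nx; apply: nUx; apply: NU; left.
  move=> nN; apply: contrapT => nd; apply: nN; apply: sN => /= h; apply: nd; apply: h.
  by rewrite !lt_neqAle ax xb eq_sym xa xb'.
apply: le_trans H4 _; rewrite lerD2l ltW//.
have tI : trivIset [set: 'I_n] (fun i : 'I_n => `]u i, v i[%classic).
  move=> i j _ _ [y /= [yi yj]]; apply/val_inj/eqP; rewrite eqn_leq.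
  move: yi yj; rewrite !in_itv/= => /andP[y1 y2] /andP[y3 y4].
  rewrite leqNgt (leqNgt j); apply/andP; split; apply/negP => ij.
    by have := H3 j i; rewrite ij ltn_ord => /(_ isT); lra.
  by have := H3 i j; rewrite ij ltn_ord => /(_ isT); lra.
apply: (acd n (fun i => u i) (fun i => v i)) => //.
  by move=> i; exact: H1.
rewrite -lte_fin; apply: le_lt_trans Ud.
rewrite -sumEFin.
have -> : (\sum_(i < n) (v i - u i)%:E =
    \sum_(i < n) lebesgue_measure `]u i, v i[%classic)%E.
  apply: eq_bigr => i _; rewrite lebesgue_measure_itv/= lte_fin EFinB.
  have [_ + _] := H1 i (ltn_ord i); rewrite le_eqVlt => /predU1P[->|->//].
  by rewrite ltxx -EFinB subrr.
rewrite -measure_semi_additive_ord//; last exact: bigsetU_measurable.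
apply: le_measure; rewrite ?inE//; first exact: bigsetU_measurable.
apply: (big_ind (fun X : set R => X `<=` U)) => // [X Y XU YU|i _].
  by rewrite subUset.
exact: H2.
Qed.

End abs_continuous_derive0.

Lemma is_derive_lin {R : realType} (f g : R -> R) (x a b df dg k : R) :
  is_derive x 1 f df -> is_derive x 1 g dg -> a * df + b * dg = k ->
  is_derive x 1 (fun t => a * f t + b * g t) k.
Proof.
move=> fdf gdg <-.
exact: (is_deriveD (is_deriveZ a fdf) (is_deriveZ b gdg)).
Qed.

Lemma abs_continuous_derive_cst {R : realType} (s t k : R) (f : R -> R) : s <= t ->
  abs_continuous_on s t f ->
  {ae @lebesgue_measure R, forall x, s < x < t -> is_derive x 1 f k} ->
  f t = f s + k * (t - s).
Proof.
move=> st acf aef.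
have := @abs_continuous_derive0 R s t (fun x => 1 * f x + (- k) * x) st
  (abs_continuous_on_lin _ _ _ _ _ _ acf (abs_continuous_on_id s t)).
have ae0 : {ae @lebesgue_measure R, forall x, s < x < t ->
    is_derive x 1 (fun x => 1 * f x + - k * x) 0}.
  apply: ae_imply aef => x h /h dfx.
  apply: (is_derive_lin _ _ _ _ _ _ _ _ dfx (is_derive_id x 1)).
  by rewrite mul1r mulr1 subrr.
by move=> /(_ ae0); lra.
Qed.

(** * The solution along the partial sums of the lengths *)

(** Solution on an interval where the Hamiltonian is [xi_a xi_a^T]: the pairing
    [u] of the row vector [(w0, w1)] with [xi_a] has derivative zero, hence is
    constant, and then both entries have constant derivatives. *)
Lemma rank_one_flow {R : realType} (s t a r : R) (w0 w1 : R -> R[i]) : s <= t ->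
  let u x := w0 x * (cos a)%:C + w1 x * (sin a)%:C in
  abs_continuous_on s t (fun x => complex.Re (w0 x)) ->
  abs_continuous_on s t (fun x => complex.Im (w0 x)) ->
  abs_continuous_on s t (fun x => complex.Re (w1 x)) ->
  abs_continuous_on s t (fun x => complex.Im (w1 x)) ->
  {ae @lebesgue_measure R, forall x, s < x < t ->
    let d0 := - ((0 +i* r) * u x * (sin a)%:C) in
    let d1 := (0 +i* r) * u x * (cos a)%:C in
    [/\ is_derive x 1 (fun x => complex.Re (w0 x)) (complex.Re d0),
        is_derive x 1 (fun x => complex.Im (w0 x)) (complex.Im d0),
        is_derive x 1 (fun x => complex.Re (w1 x)) (complex.Re d1)
      & is_derive x 1 (fun x => complex.Im (w1 x)) (complex.Im d1)]} ->
  w0 t = w0 s - (0 +i* (r * (t - s))) * u s * (sin a)%:C /\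
  w1 t = w1 s + (0 +i* (r * (t - s))) * u s * (cos a)%:C.
Proof.
move=> st u ac0r ac0i ac1r ac1i ae.
have ur x : complex.Re (u x) = cos a * complex.Re (w0 x) + sin a * complex.Re (w1 x).
  by rewrite /u; case: (w0 x) => ? ?; case: (w1 x) => ? ? /=; ring.
have ui x : complex.Im (u x) = cos a * complex.Im (w0 x) + sin a * complex.Im (w1 x).
  by rewrite /u; case: (w0 x) => ? ?; case: (w1 x) => ? ? /=; ring.
have ucst y : s <= y -> y <= t -> u y = u s.
  move=> sy yt.
  have sub f : abs_continuous_on s t f -> abs_continuous_on s y f.
    exact: abs_continuous_on_sub.
  apply/eqP; rewrite eq_complex; apply/andP; split; apply/eqP.
    rewrite !ur; have := @abs_continuous_derive_cst R s y 0 _ sy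
      (abs_continuous_on_lin _ _ (cos a) (sin a) _ _ (sub _ ac0r) (sub _ ac1r)).
    rewrite mul0r addr0; apply; apply: ae_imply ae => x h /andP[sx xy].
    have [|d0r _ d1r _] := h; first by rewrite sx (lt_le_trans xy).
    apply: (is_derive_lin _ _ _ _ _ _ _ _ d0r d1r).
    by case: (u x) => ? ? /=; ring.
  rewrite !ui; have := @abs_continuous_derive_cst R s y 0 _ sy
    (abs_continuous_on_lin _ _ (cos a) (sin a) _ _ (sub _ ac0i) (sub _ ac1i)).
  rewrite mul0r addr0; apply; apply: ae_imply ae => x h /andP[sx xy].
  have [|_ d0r _ d1r] := h; first by rewrite sx (lt_le_trans xy).
  apply: (is_derive_lin _ _ _ _ _ _ _ _ d0r d1r).
  by case: (u x) => ? ? /=; ring.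
have ae' : {ae @lebesgue_measure R, forall x, s < x < t ->
    let d0 := - ((0 +i* r) * u s * (sin a)%:C) in
    let d1 := (0 +i* r) * u s * (cos a)%:C in
    [/\ is_derive x 1 (fun x => complex.Re (w0 x)) (complex.Re d0),
        is_derive x 1 (fun x => complex.Im (w0 x)) (complex.Im d0),
        is_derive x 1 (fun x => complex.Re (w1 x)) (complex.Re d1)
      & is_derive x 1 (fun x => complex.Im (w1 x)) (complex.Im d1)]}.
  apply: ae_imply ae => x h /[dup] /h + /andP[sx xt].
  by rewrite (ucst x) ?ltW.
have E f k : abs_continuous_on s t f ->
    {ae @lebesgue_measure R, forall x, s < x < t -> is_derive x 1 f k} ->
    f t = f s + k * (t - s) by exact: abs_continuous_derive_cst.
have e0r := E _ _ ac0r (ae_imply _ _ (fun x h hx => let: And4 d _ _ _ := h hx in d) ae').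
have e0i := E _ _ ac0i (ae_imply _ _ (fun x h hx => let: And4 _ d _ _ := h hx in d) ae').
have e1r := E _ _ ac1r (ae_imply _ _ (fun x h hx => let: And4 _ _ d _ := h hx in d) ae').
have e1i := E _ _ ac1i (ae_imply _ _ (fun x h hx => let: And4 _ _ _ d := h hx in d) ae').
move: e0r e0i e1r e1i; case: (u s) => ur' ui' /= e0r e0i e1r e1i.
split; apply/eqP; rewrite eq_complex; apply/andP; split; apply/eqP;
  rewrite ?(e0r, e0i, e1r, e1i); [case: (w0 s) => ? ?|case: (w0 s) => ? ?
  |case: (w1 s) => ? ?|case: (w1 s) => ? ?] => /=; ring.
Qed.

Lemma hamburger_HE {R : realType} (l phi : nat -> R) n t : (forall j, 0 < l j) ->
  series l n <= t < series l n.+1 ->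
  hamburger_H l phi t = xi (phi n) *m (xi (phi n))^T.
Proof.
move=> l0 tn; rewrite /hamburger_H (@xget_unique _ _ _ n)// => m /andP[mt tm].
have nd : nondecreasing_seq (series l).
  by apply/nondecreasing_seqP => k; rewrite seriesSr lerDl ltW.
move: tn => /andP[nt tn]; apply/eqP; rewrite eqn_leq (leqNgt m) (leqNgt n).
apply/andP; split; apply/negP => /nd h.
  by have := lt_le_trans tn (le_trans h mt); rewrite ltxx.
by have := lt_le_trans tm (le_trans h nt); rewrite ltxx.
Qed.

Lemma mul_Jmx_row1 {C : pzRingType} (M : 'M[C]_2) :
  (M *m Jmx C) 1 0 = M 1 1 /\ (M *m Jmx C) 1 1 = - M 1 0.
Proof.
rewrite !mxE !big_ord_recl !big_ord0 !mxE/= !(mulr0, mulr1, mulrN1, addr0, add0r).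
by split; do ?congr (- _); congr (M _ _); apply/val_inj.
Qed.

Lemma mul_xi_row1 {R : realType} (M : 'M[R[i]]_2) (a : R) j :
  (M *m map_mx (real_complex R) (xi a *m (xi a)^T)) 1 j =
  (M 1 0 * (cos a)%:C + M 1 1 * (sin a)%:C) * (xi a j 0)%:C.
Proof.
rewrite !mxE !big_ord_recl !big_ord0 !mxE/= !big_ord_recl !big_ord0 !mxE/=.
have -> : lift ord0 ord0 = 1 :> 'I_2 by apply/val_inj.
by rewrite !addr0 !rmorphM/=; ring.
Qed.

Section canonical_step.
Context {R : realType}.
Variables (l phi : nat -> R) (r : R) (W : R -> 'M[R[i]]_2).
Hypothesis l0 : forall n, 0 < l n.
Hypothesis cl : cvgn (series l).
Let L := limn (series l).
Hypothesis solW : canonical_solution (hamburger_H l phi) L (0 +i* r) W.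

(** The second row of the solution. *)
Let row2 t := (W t 1 0, W t 1 1).

Let series_nd : nondecreasing_seq (series l).
Proof. by apply/nondecreasing_seqP => k; rewrite seriesSr lerDl ltW. Qed.

Let series_le n : series l n <= L.
Proof. exact: nondecreasing_cvgn_le. Qed.

Let series_ge0 n : 0 <= series l n.
Proof. by rewrite /series/= sumr_ge0// => i _; exact: ltW. Qed.

Lemma canonical_solution_step n :
  let w := row2 (series l n) in
  row2 (series l n.+1) =
   (w.1 - (0 +i* (r * l n)) * pairing w (phi n) * (sin (phi n))%:C,
    w.2 + (0 +i* (r * l n)) * pairing w (phi n) * (cos (phi n))%:C).
Proof.
have [_ acW aeW] := solW.
have st : series l n <= series l n.+1 by exact: series_nd.
have sub f : abs_continuous_on 0 L f ->
  abs_continuous_on (series l n) (series l n.+1) f by exact: abs_continuous_on_sub.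
have := @rank_one_flow R (series l n) (series l n.+1) (phi n) r
  (fun x => W x 1 0) (fun x => W x 1 1) st.
have [/sub a1 /sub a2] := acW 1 0; have [/sub a3 /sub a4] := acW 1 1.
move=> /(_ a1 a2 a3 a4) [].
  apply: ae_imply aeW => x h /andP[nx xn].
  have [|dW ddW eqW] := h.
    by rewrite (le_lt_trans (series_ge0 n) nx) (lt_le_trans xn (series_le _)).
  have HE : hamburger_H l phi x = xi (phi n) *m (xi (phi n))^T.
    by apply: hamburger_HE l0 _; rewrite (ltW nx).
  rewrite HE in eqW.
  have [j0 j1] := mul_Jmx_row1 dW.
  have e1 : dW 1 1 = (0 +i* r) * pairing (row2 x) (phi n) * (cos (phi n))%:C.
    by rewrite -j0 eqW mxE mul_xi_row1 mulrA mxE.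
  have e0 : dW 1 0 = - ((0 +i* r) * pairing (row2 x) (phi n) * (sin (phi n))%:C).
    by rewrite -[LHS]opprK -j1 eqW mxE mul_xi_row1 mulrA mxE.
  have [d1 d2] := ddW 1 0; have [d3 d4] := ddW 1 1.
  by rewrite e0 in d1 d2; rewrite e1 in d3 d4.
have -> : series l n.+1 - series l n = l n by rewrite seriesSr addrC addKr.
by rewrite /row2 => -> ->.
Qed.

Lemma canonical_solution_row2_0 : row2 (series l 0%N) = (0, 1).
Proof.
have [W0 _ _] := solW.
by rewrite /row2 /series/= big_nil W0 !mxE.
Qed.

(** A bound at all the points [x_n] passes to their limit [L]. *)
Lemma canonical_solution_bound M : (forall n t,
    Normc.normc (pairing (row2 (series l n)) t) <= M) ->
  Normc.normc (W L 1 1) <= M.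
Proof.
move=> bM; apply/ler_addgt0Pl => e e0.
have [_ acW _] := solW; have [acr aci] := acW 1 1.
have e20 : 0 < e / 2 by rewrite divr_gt0.
have [d1 d10 h1] := abs_continuous_on_right _ _ _ _ acr e20.
have [d2 d20 h2] := abs_continuous_on_right _ _ _ _ aci e20.
have /cvgrPdist_lt cvL : series l @ \oo --> L by exact: cl.
have d0 : 0 < Num.min d1 d2 by rewrite lt_min d10.
have [n _ /(_ n (leqnn n))] := cvL _ d0.
rewrite /= ger0_norm ?subr_ge0// lt_min => /andP[Ld1 Ld2].
have := h1 _ (series_ge0 n) (series_le n) Ld1.
have := h2 _ (series_ge0 n) (series_le n) Ld2.
(* The pairing of a row with [xi_(pi/2)] is its second entry. *)
have := bM n (pi / 2).
rewrite /pairing cos_pihalf sin_pihalf mulr0 add0r mulr1/=.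
set x := W (series l n) 1 1; set y := W L 1 1 => xM yi yr.
have -> : y = (y - x) + x by rewrite subrK.
apply: le_trans (le_normcD _ _) _; apply: lerD => //.
apply: le_trans (normc_le_ReIm _) _.
move: xM yi yr; case: x => x1 x2; case: y => y1 y2 /= _ yi yr.
by rewrite [leRHS]splitr ltW// ltrD.
Qed.

End canonical_step.

(** * The growth estimate *)

Theorem theorem4p4 (R : realType) :
  exists2 c : R, 0 < c &
  forall (l phi : nat -> R),
  limit_circle_hamburger l phi ->
  forall (alpha beta : R), 1 <= alpha -> 1 <= beta ->
  in_lp (1 / alpha) l ->
  in_lp (1 / beta) (fun j => `|sin (phi j.+1 - phi j)|) ->
  (* W t z = W_H(t; z) *)
  forall W : R -> R[i] -> 'M[R[i]]_2,
  (forall z : R[i],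
     canonical_solution (hamburger_H l phi) (limn (series l)) z (W ^~ z)) ->
  \forall r \near +oo%R,
    ln (Normc.normc (W (limn (series l)) (0 +i* r) 1 1)) <=
    r `^ (1 / (alpha + beta)) * (2 * c * (alpha + beta)) *
    limn (series (fun j => l j `^ (1 / alpha))) `^ (alpha / (alpha + beta)) *
    (1 + limn (series (fun j => `|sin (phi j.+1 - phi j)| `^ (1 / beta))))
      `^ (beta / (alpha + beta)).
Proof.
exists 2^-1 => // l phi [l0 cl _] a b a1 b1 la sb W solW.
have ge0a : 0 <= a by lra.
have ge0b : 0 <= b by lra.
set A := limn (series (fun j => l j `^ (1 / a))).
set B := limn (series (fun j => `|sin (phi j.+1 - phi j)| `^ (1 / b))).
have le_limn (u : nat -> R) n : (forall k, 0 <= u k) -> cvgn (series u) ->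
    series u n <= limn (series u).
  move=> u0 cu; apply: nondecreasing_cvgn_le => //.
  by apply/nondecreasing_seqP => k; rewrite seriesSr lerDl.
have series_pow0 (u : nat -> R) p n : 0 <= series (fun j => u j `^ p) n.
  by rewrite /series/= sumr_ge0// => k _; exact: powR_ge0.
have cA : cvgn (series (fun j => l j `^ (1 / a))).
  by move: la; rewrite /in_lp; under eq_fun do rewrite ger0_norm ?(ltW (l0 _))//.
have cB : cvgn (series (fun j => `|sin (phi j.+1 - phi j)| `^ (1 / b))).
  by move: sb; rewrite /in_lp; under eq_fun do rewrite normr_id.
have leA n : series (fun j => l j `^ (1 / a)) n <= A.
  by apply: le_limn cA => k; exact: powR_ge0.
have leB n : series (fun j => `|sin (phi j.+1 - phi j)| `^ (1 / b)) n <= B.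
  by apply: le_limn cB => k; exact: powR_ge0.
have A0 : 0 <= A by exact: le_trans (leA 0%N).
have B0 : 0 <= B by exact: le_trans (leB 0%N).
near=> r.
have r0 : 0 <= r by near: r; exact: nbhs_pinfty_ge.
rewrite mulfV// (mul1r (a + b)).
set w := W (limn (series l)) (0 +i* r) 1 1.
set E := (leRHS).
have wE : Normc.normc w <= expR E.
  apply: (canonical_solution_bound l phi r (W ^~ (0 +i* r)) l0 cl (solW _)) => n t.
  have [_ /(_ t) bd] := @pairing_bound R l phi a b r
    (fun n => (W (series l n) (0 +i* r) 1 0, W (series l n) (0 +i* r) 1 1))
    (fun k => ltW (l0 k)) a1 b1 r0
    (canonical_solution_row2_0 l phi r (W ^~ (0 +i* r)) (solW _))
    (canonical_solution_step l phi r (W ^~ (0 +i* r)) l0 cl (solW _)) n.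
  apply: le_trans bd _.
  apply: le_trans (sum_powfact_le a b r A (1 + B) n.+1 a1 b1 r0 A0 _); last first.
    exact: addr_ge0.
  apply: ler_sum => k _; rewrite -!mulrA ler_wpM2l ?exprn_ge0//.
  apply: ler_pM; rewrite ?powfact_ge0// powfact_le ?lerD2l//.
  by rewrite addr_ge0// series_pow0.
(* The logarithm of zero is zero by convention. *)
have [w0|w0] := leP (Normc.normc w) 0.
  rewrite ln0//; rewrite /E !mulr_ge0 ?powR_ge0 ?addr_ge0//.
by rewrite -ler_expR lnK// posrE.
Unshelve. all: by end_near. Qed.
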